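(* There is a function $\varepsilon:\mathbb{Z}_{\ge 1}\to\mathbb{R}_{\ge 0}$ with $\varepsilon(n)\to 0$ as $n\to\infty$ such that the following holds. Let $G$ be a finite cyclic group of order $n$ with generator $\gamma$, let $D:G\times G\to G$ be the bivariate Diffie-Hellman mapping $D(\gamma^a,\gamma^b)=\gamma^{ab}$, $a,b=0,\ldots,n-1$, and let $f:G\times G\to G$ be any mapping having $(\ell_1,\ell_2)$ as an index pair. Then the number of pairs $(x,y)\in G\times G$ with $f(x,y)=D(x,y)$ is at most $\ell_1\ell_2\, n^{1+\varepsilon(n)}$.
   Context: For a positive divisor $\ell$ of $n$, let $C_{\ell,0}=\{\gamma^{j\ell}: j=0,1,\ldots,n/\ell-1\}$ and $C_{\ell,i}=\gamma^i C_{\ell,0}$ for $i=0,1,\ldots,\ell-1$. For positive divisors $\ell_1,\ell_2$ of $n$, a pair $(\ell_1,\ell_2)$ is called an index pair of a mapping $f:G\times G\to G$ if there exist positive integers $r_1,r_2$ and elements $a_{k_1,k_2}\in G$ ($0\le k_1\le \ell_1-1$, $0\le k_2\le \ell_2-1$) such that $f(x,y)=a_{k_1,k_2}x^{r_1}y^{r_2}$ whenever $(x,y)\in C_{\ell_1,k_1}\times C_{\ell_2,k_2}$. *)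

(* Defs.v *)
From HB Require Import structures.
From mathcomp Require Import all_boot all_order all_fingroup all_algebra all_solvable.
From mathcomp Require Import all_classical all_reals all_analysis.
Set Implicit Arguments.
Unset Strict Implicit.
Unset Printing Implicit Defensive.

Import GroupScope.

Definition power_subgroup (G : finGroupType) (gamma : G) (l : nat) : {set G} :=
  [set gamma ^+ (j * l)%N | j : 'I_(#|G| %/ l)].

Definition power_coset (G : finGroupType) (gamma : G) (l i : nat) : {set G} :=
  gamma ^+ i *: power_subgroup gamma l.

Definition index_pair (G : finGroupType) (gamma : G) (f : G * G -> G)
    (l1 l2 : nat) : Prop :=
  [/\ (0 < l1)%N /\ l1 %| #|G|,
      (0 < l2)%N /\ l2 %| #|G| &
      exists (r1 r2 : nat) (a : 'I_l1 -> 'I_l2 -> G),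
        [/\ (0 < r1)%N, (0 < r2)%N &
            forall (k1 : 'I_l1) (k2 : 'I_l2) (x y : G),
              x \in power_coset gamma l1 k1 ->
              y \in power_coset gamma l2 k2 ->
              f (x, y) = a k1 k2 * x ^+ r1 * y ^+ r2]].

(* When gamma generates G, this determines D, and such a D exists
   (bivariate_DH_ex). *)
Definition bivariate_DH (G : finGroupType) (gamma : G) (D : G * G -> G) : Prop :=
  forall a b : nat, (a < #|G|)%N -> (b < #|G|)%N ->
    D (gamma ^+ a, gamma ^+ b) = gamma ^+ (a * b)%N.

Lemma bivariate_DH_ex (G : finGroupType) (gamma : G) :
  generator [set: G] gamma -> exists D, bivariate_DH gamma D.
Proof.
move=> /eqP gen; have og : #[gamma] = #|G| by rewrite orderE -gen cardsT.
pose dlog x := index x [seq gamma ^+ i | i <- iota 0 #|G|].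
have dlogE a : (a < #|G|)%N -> dlog (gamma ^+ a) = a.
  move=> lt_a; have -> : gamma ^+ a = nth 1 [seq gamma ^+ i | i <- iota 0 #|G|] a.
    by rewrite (nth_map 0%N) ?size_iota // nth_iota.
  rewrite /dlog index_uniq ?size_map ?size_iota //.
  rewrite map_inj_in_uniq ?iota_uniq // => i j; rewrite !mem_iota /= !add0n => lti ltj /eqP.
  by rewrite eq_expg_mod_order og !modn_small // => /eqP.
by exists (fun z => gamma ^+ (dlog z.1 * dlog z.2)%N) => a b lta ltb /=; rewrite !dlogE.
Qed.

(* Main.v *)
Require Import Defs.
From mathcomp Require Import all_boot all_order all_fingroup all_algebra all_solvable.
From mathcomp Require Import all_classical all_reals all_analysis.
From mathcomp Require Import ring.
Import Order.TTheory GRing.Theory Num.Theory.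
Import numFieldNormedType.Exports.

(** For exponents [u], [v] with classes [u %% l1] and [v %% l2] fixed, agreement
    means [u * v = al + r1 * u + r2 * v] modulo [n].  For given [u] this is a
    linear congruence in [v] with coefficient [u - r2], so it has at most
    [gcd (u - r2, n)] solutions; summing over [u] gives at most [n * d(n)]
    agreements per class, where [d(n)] is the number of divisors of [n].  The
    divisor bound [d(n) = n ^ o(1)] then allows [eps n = ln (d(n)) / ln n], whose
    values at [n = 0] and [n = 1] are [0] since [ln 0 = ln 1 = 0]. *)

(** A prime power [p ^ e] adds [e] rounds to the construction of the list, each merging the previous
    list into the [p]-multiples, so the length is multiplied by [e + 1]. *)
Lemma size_divisors (n : nat) :
  size (divisors n) = \prod_(f <- prime_decomp n) f.2.+1.
Proof.
rewrite /divisors; elim: (prime_decomp n) => [|[p e] s IHs] /=.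
  by rewrite big_nil.
rewrite big_cons -{}IHs /=; set ds := foldr _ _ s.
elim: e => [|e IHe]; first by rewrite mul1n.
by rewrite /= size_merge size_cat size_map IHe addnC mulSn.
Qed.

Lemma size_divisors_gt0 (n : nat) : 0 < size (divisors n).
Proof. by rewrite size_divisors prodn_gt0. Qed.

(** With [q = e %/ k], one has [e + 1 <= k * (q + 1) <= k * 2 ^ q]; take [k]-th powers and use
    [q * k <= e]. *)
Lemma succn_exp_le (k e : nat) : 0 < k -> e.+1 ^ k <= k ^ k * 2 ^ e.
Proof.
move=> k_gt0; have le_e : e.+1 <= k * 2 ^ (e %/ k).
  apply: (leq_trans (ltn_ceil e k_gt0)); rewrite mulnC leq_pmul2l //.
  exact: ltn_expl.
apply: (@leq_trans ((k * 2 ^ (e %/ k)) ^ k)); first by rewrite leq_exp2r.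
by rewrite expnMn -expnM leq_pmul2l ?expn_gt0 ?k_gt0 // leq_exp2l // leq_trunc_div.
Qed.

Lemma count_ltn_uniq (s : seq nat) (b : nat) :
  uniq s -> count (fun p => p < b) s <= b.
Proof.
move=> s_uniq; rewrite -size_filter -[leqRHS](size_iota 0).
apply: uniq_leq_size; first exact: filter_uniq.
by move=> p; rewrite mem_filter mem_iota => /andP[].
Qed.

(* A prime [p >= 2 ^ k] has [(e + 1) ^ k <= 2 ^ (k * e) <= p ^ e], so only the
   primes below [2 ^ k] contribute to the constant. *)
Lemma size_divisors_exp_le (k n : nat) : 0 < k -> 0 < n ->
  size (divisors n) ^ k <= (k ^ k) ^ (2 ^ k) * n.
Proof.
move=> k_gt0 n_gt0; have K_gt0 : 0 < k ^ k by rewrite expn_gt0 k_gt0.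
pose w (f : nat * nat) := if f.1 < 2 ^ k then k ^ k else 1.
have w_le : \prod_(f <- prime_decomp n) w f <= (k ^ k) ^ (2 ^ k).
  rewrite /w -big_mkcond /= big_const_seq iter_muln_1.
  rewrite leq_pexp2l // -(count_map fst (fun p => p < 2 ^ k)).
  exact/count_ltn_uniq/primes_uniq.
rewrite [in leqRHS](prod_prime_decomp n_gt0) size_divisors.
apply: leq_trans (leq_mul w_le (leqnn _)); rewrite -big_split /=.
rewrite (big_morph (fun m => m ^ k) (fun a b => expnMn a b k) (exp1n k)).
rewrite big_seq [leqRHS]big_seq; apply: leq_prod => -[p e].
case/mem_prime_decomp=> p_pr _ _; rewrite /w /=.
case: ltnP => [_|le_p].
  apply: leq_trans (succn_exp_le _ _ k_gt0) _; rewrite leq_pmul2l //.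
  by case: e => // e; rewrite leq_exp2r // prime_gt1.
rewrite mul1n; apply: (@leq_trans ((2 ^ e) ^ k)).
  by rewrite leq_exp2r // ltn_expl.
by rewrite -expnM mulnC expnM; case: e => // e; rewrite leq_exp2r.
Qed.

(** Elements with a common remainder are separated by their quotients by [d], which lie below
    [n %/ d]. *)
Lemma card_pairwise_modn_le (n d : nat) (A : {set 'I_n}) : d %| n ->
  {in A &, forall u v : 'I_n, u = v %[mod d]} -> #|A| <= n %/ d.
Proof.
move=> d_dvd A_cong; have [->|[u0 _]] := set_0Vmem A.
  by rewrite cards0.
have n_gt0 : 0 < n by apply: leq_ltn_trans (ltn_ord u0).
have d_gt0 : 0 < d := dvdn_gt0 n_gt0 d_dvd.
have q_lt (u : 'I_n) : u %/ d < n %/ d by rewrite ltn_divLR // divnK.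
pose q u := Ordinal (q_lt u); rewrite -[leqRHS]card_ord.
rewrite -(card_in_imset (f := q)) ?max_card // => u v uA vA /(congr1 val) /= quv.
by apply: val_inj; rewrite /= (divn_eq u d) (divn_eq v d) quv (A_cong u v).
Qed.

Lemma eqn_mod_mull (s n u v : nat) : 0 < n ->
  s * u = s * v %[mod n] -> u = v %[mod n %/ gcdn s n].
Proof.
(* Ordering the two keeps the truncated difference [u - v] faithful. *)
move=> n_gt0; wlog le_vu : u v / v <= u => [wl|].
  by case/orP: (leq_total u v) => ? h; [apply/esym/wl|apply/wl].
have g_gt0 : 0 < gcdn s n by rewrite gcdn_gt0 n_gt0 orbT.
move=> /eqP; rewrite eqn_mod_dvd ?leq_mul2l ?le_vu ?orbT // -mulnBr => n_dvd.
apply/eqP; rewrite eqn_mod_dvd //.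
have cop : coprime (n %/ gcdn s n) (s %/ gcdn s n).
  by rewrite /coprime -(eqn_pmul2r g_gt0) muln_gcdl !divnK ?dvdn_gcdl ?dvdn_gcdr // mul1n gcdnC.
rewrite -(Gauss_dvdr _ cop) -(dvdn_pmul2r g_gt0) divnK ?dvdn_gcdr //.
by rewrite mulnAC divnK ?dvdn_gcdl.
Qed.

(** The gcd is one of the divisors [d] of [n] dividing [u + c], so it is at most their sum. After
    exchanging sums, each [d] occurs for at most [n %/ d] values of [u] and contributes at most
    [n]. *)
Lemma sum_gcdn_le (n c : nat) : 0 < n ->
  \sum_(u < n) gcdn (u + c) n <= n * size (divisors n).
Proof.
move=> n_gt0.
apply: (@leq_trans (\sum_(u < n) \sum_(d <- divisors n | d %| u + c) d)).
  apply: leq_sum => u _; rewrite (big_rem (gcdn (u + c) n)) /=.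
    by rewrite dvdn_gcdl leq_addr.
  by rewrite -dvdn_divisors // dvdn_gcdr.
under eq_bigr do rewrite big_mkcond.
rewrite exchange_big /= mulnC.
have -> : size (divisors n) * n = \sum_(d <- divisors n) n.
  by rewrite big_const_seq count_predT iter_addn_0 mulnC.
rewrite big_seq [leqRHS]big_seq; apply: leq_sum => d.
rewrite -dvdn_divisors // => d_dvd.
rewrite -big_mkcond /= sum_nat_const -leq_divRL ?(dvdn_gt0 n_gt0) //.
rewrite -cardsE; apply: card_pairwise_modn_le => // u v.
rewrite !inE => /eqP du /eqP dv; apply/eqP.
by rewrite -(eqn_modDr c) du dv.
Qed.

(* [u + r2 * n.-1] stands for [u - r2] modulo [n]. *)
Lemma card_mul_affine_solutions_le (n al r1 r2 : nat) : 0 < n ->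
  #|[set z : 'I_n * 'I_n | z.1 * z.2 == al + r1 * z.1 + r2 * z.2 %[mod n]]|
    <= n * size (divisors n).
Proof.
move=> n_gt0; set S := finset _.
apply: leq_trans (sum_gcdn_le n (r2 * n.-1) n_gt0).
have -> : #|S| = \sum_(u < n) #|[set v : 'I_n | (u, v) \in S]|.
  rewrite -sum1_card (eq_bigl (fun z => true && ((z.1, z.2) \in S))); last by case.
  rewrite -(pair_big_dep xpredT (fun u v => (u, v) \in S) (fun _ _ => 1)) /=.
  by apply: eq_bigr => u _; rewrite sum1dep_card cardsE.
apply: leq_sum => u _; set g := gcdn _ n.
have g_gt0 : 0 < g by rewrite gcdn_gt0 n_gt0 orbT.
have g_dvd : g %| n by apply: dvdn_gcdr.
have q_dvd : n %/ g %| n by rewrite dvdn_divLR ?dvdn_mulr.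
(* In this form the bound [g] follows once all solutions [v] agree modulo [n %/ g]. *)
have -> : g = n %/ (n %/ g) by rewrite divnA ?mulKn.
apply: card_pairwise_modn_le => // v w; rewrite !inE /= => /eqP eqv /eqP eqw.
apply: (eqn_mod_mull (u + r2 * n.-1)) => //.
have E (t : 'I_n) : u * t = al + r1 * u + r2 * t %[mod n] ->
    (u + r2 * n.-1) * t = al + r1 * u %[mod n].
  move=> et; rewrite mulnDl -modnDml et modnDml -addnA mulnAC -mulnS prednK //.
  by rewrite addnC modnMDl.
by rewrite !E.
Qed.

Lemma generator_expgP (G : finGroupType) (gamma : G) :
  generator [set: G] gamma ->
  forall g : G, exists2 m, m < #|G| & g = (gamma ^+ m)%g.
Proof.
move=> /eqP gen g; have : g \in <[gamma]>%g by rewrite -gen inE.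
by case/cyclePmin=> m; rewrite orderE -gen cardsT => lt_m ->; exists m.
Qed.

Lemma expg_mem_power_coset (G : finGroupType) (gamma : G) (l u : nat) :
  0 < l -> l %| #|G| -> u < #|G| ->
  (gamma ^+ u)%g \in power_coset gamma l (u %% l).
Proof.
move=> l_gt0 l_dvd lt_u; have lt_q : u %/ l < #|G| %/ l.
  by rewrite ltn_divLR // divnK.
apply/lcosetP; exists (gamma ^+ (u %/ l * l))%g.
  by apply/imsetP; exists (Ordinal lt_q).
by rewrite -expgD addnC -divn_eq.
Qed.

Lemma card_bigcup_le (I T : finType) (A : I -> {set T}) :
  #|\bigcup_i A i| <= \sum_i #|A i|.
Proof.
apply: (big_ind2 (fun (B : {set T}) m => #|B| <= m)) => [|B m C p leB leC|//].
  by rewrite cards0.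
exact: leq_trans (leq_card_setU B C) (leq_add leB leC).
Qed.

Lemma card_eq_bivariate_DH_le (G : finGroupType) (gamma : G)
    (D f : G * G -> G) (l1 l2 : nat) :
  generator [set: G] gamma -> bivariate_DH gamma D -> index_pair gamma f l1 l2 ->
  #|[set z | f z == D z]| <= l1 * l2 * (#|G| * size (divisors #|G|)).
Proof.
move=> gen DH [[l1_gt0 l1_dvd] [l2_gt0 l2_dvd] [r1 [r2 [a [_ _ fE]]]]].
have og : #[gamma]%g = #|G| by move/eqP: gen => gen; rewrite orderE -gen cardsT.
have n_gt0 : 0 < #|G| by rewrite -og order_gt0.
have dlog g : {m | g == (gamma ^+ m)%g}.
  by apply: sigW; have [m _ ->] := generator_expgP _ _ gen g; exists m.
pose al (k : 'I_l1 * 'I_l2) := sval (dlog (a k.1 k.2)).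
(* [S k] ranges over all exponent pairs, not only those in class [k], so each of the [l1 * l2]
   classes is charged the full bound. *)
pose S k := [set z : 'I_#|G| * 'I_#|G| |
  z.1 * z.2 == al k + r1 * z.1 + r2 * z.2 %[mod #|G|]].
pose e (z : 'I_#|G| * 'I_#|G|) := ((gamma ^+ z.1)%g, (gamma ^+ z.2)%g).
have sub : [set z | f z == D z] \subset \bigcup_k (e @: S k).
  apply/fintype.subsetP=> -[x y]; rewrite inE.
  have [u lt_u ->] := generator_expgP _ _ gen x.
  have [v lt_v ->] := generator_expgP _ _ gen y.
  have lt_k1 : u %% l1 < l1 by rewrite ltn_pmod.
  have lt_k2 : v %% l2 < l2 by rewrite ltn_pmod.
  pose k := (Ordinal lt_k1, Ordinal lt_k2).
  rewrite DH // (fE k.1 k.2) ?expg_mem_power_coset // => fD.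
  apply/finset.bigcupP; exists k => //; apply/imsetP.
  exists (Ordinal lt_u, Ordinal lt_v) => //; rewrite inE /=.
  move: fD; have /eqP -> := svalP (dlog (a k.1 k.2)); rewrite -/(al k).
  by rewrite -!expgM -!expgD eq_expg_mod_order og eq_sym ![_ * r1]mulnC ![_ * r2]mulnC.
apply: leq_trans (subset_leq_card sub) _; apply: leq_trans (card_bigcup_le _ _ _) _.
rewrite -[l1 in leqRHS]card_ord -[l2 in leqRHS]card_ord -card_prod -sum_nat_const.
apply: leq_sum => k _; apply: leq_trans (leq_imset_card _ _) _.
exact: card_mul_affine_solutions_le.
Qed.

Local Open Scope classical_set_scope.
Local Open Scope ring_scope.

(** Taking logarithms in [d(n) ^ k <= C * n] gives [ln (d(n)) / ln n <= ln C / (k * ln n) + 1 / k];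
    [k] and then [n] are taken large enough to make each term at most [e / 2]. *)
Lemma cvg_ln_size_divisors (R : realType) :
  (ln (size (divisors n))%:R / ln n%:R : R) @[n --> \oo] --> (0 : R).
Proof.
apply/cvgrPdist_le => e e_gt0.
pose k := (Num.truncn (2 / e)).+1; pose C : R := ((k ^ k) ^ (2 ^ k))%:R.
have k_gt0 : 0 < k%:R :> R by rewrite ltr0n.
have k_le : k%:R^-1 <= e / 2.
  rewrite -[leRHS]invf_div lef_pV2 ?posrE ?divr_gt0 //.
  by apply/ltW; rewrite truncnS_gt.
have C_gt0 : 0 < C by rewrite ltr0n !expn_gt0.
pose M := expR (ln C / (k%:R * (e / 2))).
(* The bound [2] makes [ln n] positive; exceeding [M] gives [ln C / (k * ln n) < e / 2]. *)
exists (maxn 2 (Num.truncn M).+1) => //= n /=.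
rewrite geq_max => /andP[n_gt1 le_Mn].
have n_gt0 : (0 < n)%N by apply: ltnW.
have lnn_gt0 : 0 < ln n%:R :> R by rewrite ln_gt0 // ltr1n.
have d_gt0 : (0 < size (divisors n))%N.
  exact: size_divisors_gt0.
have M_lt : M < n%:R by apply: lt_le_trans (truncnS_gt M) _; rewrite ler_nat.
have lnC_lt : ln C / (k%:R * (e / 2)) < ln n%:R.
  by rewrite -[ltLHS]expRK ltr_ln ?posrE ?expR_gt0 ?ltr0n.
rewrite sub0r normrN ger0_norm; last first.
  by rewrite divr_ge0 ?ln_ge0 ?ler1n.
rewrite ler_pdivrMr //.
have : ln ((size (divisors n) ^ k)%:R : R) <= ln (C * n%:R).
  rewrite ler_ln ?posrE ?mulr_gt0 ?ltr0n ?expn_gt0 ?d_gt0 //.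
  by rewrite /C -natrM ler_nat size_divisors_exp_le.
rewrite natrX lnXn ?ltr0n // lnM ?posrE ?ltr0n ?expn_gt0 // => le_kd.
rewrite -(ler_pM2l k_gt0) [leLHS]mulr_natl (le_trans le_kd) //.
have -> : k%:R * (e * ln n%:R) =
    ln n%:R * (k%:R * (e / 2)) + k%:R * (e / 2) * ln n%:R :> R by field.
rewrite lerD //; first by rewrite -ler_pdivrMr ?mulr_gt0 ?divr_gt0 // ltW.
rewrite ler_peMl ?(ltW lnn_gt0) //.
by rewrite -ler_pdivrMl // mulr1.
Qed.

Theorem theorem4 (R : realType) :
  exists eps : nat -> R,
    [/\ forall n : nat, (0 < n)%N -> 0 <= eps n,
        eps n @[n --> \oo] --> (0 : R) &
        forall (G : finGroupType) (gamma : G) (D f : G * G -> G) (l1 l2 : nat),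
          generator [set: G]%SET gamma ->
          bivariate_DH gamma D ->
          index_pair gamma f l1 l2 ->
          (#|[set z : G * G | f z == D z]%SET|%:R : R)
            <= (l1 * l2)%:R * #|G|%:R `^ (1 + eps #|G|)].
Proof.
exists (fun n => ln (size (divisors n))%:R / ln n%:R); split.
- move=> n n_gt0; rewrite divr_ge0 ?ln_ge0 ?ler1n //.
  exact: size_divisors_gt0.
- exact: cvg_ln_size_divisors.
move=> G gamma D f l1 l2 gen DH ip.
have n_gt0 : (0 < #|G|)%N by apply/card_gt0P; exists gamma.
apply: (@le_trans _ _ (l1 * l2 * (#|G| * size (divisors #|G|)))%:R).
  by rewrite ler_nat (card_eq_bivariate_DH_le _ _ _ _ _ _ gen DH ip).
rewrite natrM ler_wpM2l ?ler0n // natrM powRD; last first.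
  by rewrite pnatr_eq0 -lt0n n_gt0 implybT.
rewrite powRr1 ?ler0n // ler_wpM2l ?ler0n //.
(* For [n > 1], [n] to the power [eps n] is exactly [d(n)]. The case [n = 1] is separate because
   [ln 1 = 0] cannot be cancelled. *)
have [n1|n_neq1] := eqVneq #|G| 1%N; first by rewrite n1 powR1.
have n_gt1 : (1 < #|G|)%N by rewrite ltn_neqAle eq_sym n_neq1.
rewrite /powR gt_eqF ?ltr0n // divfK; last by rewrite gt_eqF // ln_gt0 // ltr1n.
by rewrite lnK // posrE ltr0n size_divisors_gt0.
Qed.
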